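(* Let $k$ be a field. For every integer $n \geq 225$ and every even integer $2m$ with $0 \leq 2m \leq n^{2} - \frac{9}{2}n\sqrt{n}$, the matrix algebra $\mathrm{M}_{n}(k)$ contains a connected semi-simple subalgebra of dimension $n + 2m$.
   Context: $\mathrm{M}_{n}(k)$ denotes the $k$-algebra of all $n\times n$ matrices over $k$. A connected semi-simple subalgebra (CSA) of $\mathrm{M}_{n}(k)$ is a subalgebra isomorphic to a direct sum $\bigoplus_{i=1}^{t}\mathrm{M}_{n_i}(k)$ of full matrix algebras with $n_1+\cdots+n_t = n$ (for instance, the algebra of block-diagonal matrices whose diagonal blocks are arbitrary $n_i\times n_i$ matrices); its dimension as a $k$-vector space is $\sum_{i} n_i^{2}$. *)

(* Defs.v *)
From HB Require Import structures.
From mathcomp Require Import all_boot all_order all_algebra.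

Set Implicit Arguments.
Unset Strict Implicit.
Unset Printing Implicit Defensive.

Import GRing.Theory.
Local Open Scope ring_scope.

(* The direct sum (= finite product) of the matrix algebras 'M[k]_(d i).      *)
(* The library equips only the non-dependent {ffun I -> R} with ring and      *)
(* module structures, so the componentwise operations are set up here.        *)
(* Since 'M[k]_0 is the zero ring, 'M[k]_n and this sum are a pzRingType and  *)
(* an lmodType, but not an algType, for general sizes.                        *)
Definition mxsum (k : fieldType) (t : nat) (d : 'I_t -> nat) : Type :=
  {dffun forall i : 'I_t, 'M[k]_(d i)}.

Section MxSum.

Variables (k : fieldType) (t : nat) (d : 'I_t -> nat).

HB.instance Definition _ :=
  Choice.copy (mxsum k d) {dffun forall i : 'I_t, 'M[k]_(d i)}.

Implicit Types u v w : mxsum k d.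

Definition mxsum0 : mxsum k d := finfun (fun i => 0 : 'M[k]_(d i)).
Definition mxsum1 : mxsum k d := finfun (fun i => 1 : 'M[k]_(d i)).
Definition mxsum_opp u : mxsum k d := finfun (fun i => - u i).
Definition mxsum_add u v : mxsum k d := finfun (fun i => u i + v i).
Definition mxsum_mul u v : mxsum k d := finfun (fun i => u i * v i).
Definition mxsum_scale (a : k) u : mxsum k d := finfun (fun i => a *: u i).

Fact mxsum_addA : associative mxsum_add.
Proof. by move=> u v w; apply/ffunP => i; rewrite !ffunE addrA. Qed.
Fact mxsum_addC : commutative mxsum_add.
Proof. by move=> u v; apply/ffunP => i; rewrite !ffunE addrC. Qed.
Fact mxsum_add0 : left_id mxsum0 mxsum_add.
Proof. by move=> u; apply/ffunP => i; rewrite !ffunE add0r. Qed.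
Fact mxsum_addN : left_inverse mxsum0 mxsum_opp mxsum_add.
Proof. by move=> u; apply/ffunP => i; rewrite !ffunE addNr. Qed.

HB.instance Definition _ := GRing.isZmodule.Build (mxsum k d)
  mxsum_addA mxsum_addC mxsum_add0 mxsum_addN.

Fact mxsum_mulA : associative mxsum_mul.
Proof. by move=> u v w; apply/ffunP => i; rewrite !ffunE mulrA. Qed.
Fact mxsum_mul1 : left_id mxsum1 mxsum_mul.
Proof. by move=> u; apply/ffunP => i; rewrite !ffunE mul1r. Qed.
Fact mxsum_mulr1 : right_id mxsum1 mxsum_mul.
Proof. by move=> u; apply/ffunP => i; rewrite !ffunE mulr1. Qed.
Fact mxsum_mulDl : left_distributive mxsum_mul +%R.
Proof. by move=> u v w; apply/ffunP => i; rewrite !ffunE mulrDl. Qed.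
Fact mxsum_mulDr : right_distributive mxsum_mul +%R.
Proof. by move=> u v w; apply/ffunP => i; rewrite !ffunE mulrDr. Qed.

HB.instance Definition _ := GRing.Zmodule_isPzRing.Build (mxsum k d)
  mxsum_mulA mxsum_mul1 mxsum_mulr1 mxsum_mulDl mxsum_mulDr.

Fact mxsum_scaleA a b u :
  mxsum_scale a (mxsum_scale b u) = mxsum_scale (a * b) u.
Proof. by apply/ffunP => i; rewrite !ffunE scalerA. Qed.
Fact mxsum_scale1 : left_id 1 mxsum_scale.
Proof. by move=> u; apply/ffunP => i; rewrite !ffunE scale1r. Qed.
Fact mxsum_scaleDr : right_distributive mxsum_scale +%R.
Proof. by move=> a u v; apply/ffunP => i; rewrite !ffunE scalerDr. Qed.
Fact mxsum_scaleDl u : {morph mxsum_scale^~ u : a b / a + b}.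
Proof. by move=> a b; apply/ffunP => i; rewrite !ffunE scalerDl. Qed.

HB.instance Definition _ := GRing.Zmodule_isLmodule.Build k (mxsum k d)
  mxsum_scaleA mxsum_scale1 mxsum_scaleDr mxsum_scaleDl.

End MxSum.

(* A {vspace 'M[k]_n} is already k-linear, so only 1 and products remain.     *)
Definition is_subalgebra (k : fieldType) (n : nat) (A : {vspace 'M[k]_n}) :
  Prop := GRing.mulr_closed A.

(* Isomorphism is witnessed by an injective k-algebra morphism into 'M[k]_n   *)
(* whose image is A.                                                          *)
Definition is_CSA (k : fieldType) (n : nat) (A : {vspace 'M[k]_n}) : Prop :=
  is_subalgebra A /\
  exists (t : nat) (d : 'I_t -> nat) (f : {linear mxsum k d -> 'M[k]_n}),
    [/\ forall i, (0 < d i)%N,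
        (\sum_(i < t) d i)%N = n,
        monoid_morphism f,
        injective f
      & forall x, x \in A <-> exists u, f u = x].

(* Main.v *)
(* Block-diagonal algebras reduce the claim to arithmetic: since              *)
(* a ^ 2 = a + 2 * 'C(a, 2), it suffices to write m as a sum of binomials     *)
(* 'C(a_i, 2) with a_i > 0 and a_1 + ... + a_t = n; parts equal to 1 are free *)
(* padding, so only a_1 + ... + a_t <= n matters. Subtracting greedily the    *)
(* largest 'C(b.+1, 2) from m and then the largest 'C(c.+1, 2) from the       *)
(* remainder leaves q <= c, with c of order sqrt(2 * b); any such q is        *)
(* handled at cost at most (q + 16) / 3. The total is about b + 4 * c / 3,    *)
(* and the hypothesis forces b <= n - 9 / 4 * sqrt n - 3, while               *)
(* 4 / 3 * sqrt 2 < 9 / 4 leaves enough room once sqrt n >= 15.               *)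
Require Import Defs.
From HB Require Import structures.
From mathcomp Require Import all_boot all_order all_algebra.
From mathcomp Require Import zify ring lra.

Import Order.TTheory GRing.Theory Num.Theory.

Set Implicit Arguments.

(** The arithmetic and the algebra meet in [decomposable_CSA], where the parts become block sizes.
    The parts come from [triangular_root], applied to m and then to its remainder, and from
    [decomposable_third] for what is left; [greedy_cost_bound] shows that they fit into n. *)

Lemma sqrn_bin2 a : a ^ 2 = a + 2 * 'C(a, 2).
Proof. by elim: a => // a IHa; rewrite binS bin1; lia. Qed.

Lemma bin2M2 (b : nat) : 2 * 'C(b.+1, 2) = b * b.+1.
Proof. by have := sqrn_bin2 b.+1; lia. Qed.

Definition decomposable (n m : nat) : Prop :=
  exists l : seq nat,
    [/\ all (leq 1) l, sumn l = n & sumn [seq 'C(a, 2) | a <- l] = m].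

Lemma decomposable_add (a n m : nat) :
  decomposable n m -> decomposable (a.+1 + n) ('C(a.+1, 2) + m).
Proof. by case=> l [l_gt0 <- <-]; exists (a.+1 :: l). Qed.

Lemma decomposable_leq (n n' m : nat) :
  n <= n' -> decomposable n m -> decomposable n' m.
Proof.
move/subnK <-; elim: (n' - n) => //= d IHd /IHd.
exact: (decomposable_add 0).
Qed.

(* A part 7 contributes 21 = 3 * 7, so only r < 21 needs checking. *)
Lemma decomposable_third (r : nat) :
  exists2 s, 3 * s <= r + 16 & decomposable s r.
Proof.
elim/ltn_ind: r => r IHr.
have [r_lt|r_ge] := ltnP r 21.
  (* Entry i lists parts whose binomials sum to i. The allowance 16 is attained at i = 5, 8 and
     14. *)
  pose tbl := [:: [::]; [:: 2]; [:: 2; 2]; [:: 3]; [:: 3; 2]; [:: 3; 2; 2];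
    [:: 4]; [:: 4; 2]; [:: 4; 2; 2]; [:: 4; 3]; [:: 5]; [:: 5; 2]; [:: 4; 4];
    [:: 5; 3]; [:: 5; 3; 2]; [:: 6]; [:: 6; 2]; [:: 6; 2; 2]; [:: 6; 3];
    [:: 6; 3; 2]; [:: 5; 5]].
  have tblP : all (fun i => let l := nth [::] tbl i in
    [&& 3 * sumn l <= i + 16, all (leq 1) l & sumn [seq 'C(a, 2) | a <- l] == i])
    (iota 0 21) by [].
  move/allP/(_ r): tblP; rewrite mem_iota r_lt => /(_ isT) /and3P[le_s gt0 /eqP E].
  by exists (sumn (nth [::] tbl r)) => //; exists (nth [::] tbl r).
have [|s le_s dec_s] := IHr (r - 21); first lia.
exists (7 + s); first lia.
by rewrite -(subnKC r_ge); apply: (decomposable_add 6).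
Qed.

(** Consecutive triangular numbers 'C(b.+1, 2) and 'C(b.+2, 2) differ by b + 1, so a remainder about
    to reach b + 1 is absorbed by the next one. *)
Lemma triangular_root (m : nat) : exists b r, m = 'C(b.+1, 2) + r /\ r <= b.
Proof.
elim: m => [|m [b [r [-> r_le]]]]; first by exists 0, 0.
have [r_lt|r_ge] := ltnP r b; first by exists b, r.+1; rewrite addnS.
by exists b.+1, 0; rewrite (binS b.+1) bin1; split => //; lia.
Qed.

Lemma decomposable_greedy (b c q : nat) : q <= c ->
  exists2 s, 3 * s <= 3 * b + 4 * c + 22 &
    decomposable s ('C(b.+1, 2) + ('C(c.+1, 2) + q)).
Proof.
move=> q_le; have [s le_s dec_s] := decomposable_third q.
exists (b.+1 + (c.+1 + s)); first lia.
by do 2!apply: decomposable_add.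
Qed.

Local Open Scope ring_scope.

(** Here x stands for the square root of n. Since u (u + 1) increases for u >= 0, each quadratic
    hypothesis bounds its variable by comparison with a linear or quadratic polynomial in x. *)
Lemma greedy_cost_bound (R : realFieldType) (x b c : R) :
  15 <= x -> 0 <= b -> 0 <= c ->
  b * (b + 1) <= x ^+ 4 - 9 / 2 * x ^+ 2 * x -> c * (c + 1) <= 2 * b ->
  3 * b + 4 * c + 22 <= 3 * x ^+ 2.
Proof.
move=> x15 b0 c0 hb hc.
have sqr_lt (u v : R) : 0 <= u -> u < v -> u * (u + 1) < v * (v + 1).
  by move=> u0 uv; apply: ltr_pM; lra.
have x2 : 15 * x <= x ^+ 2 by rewrite expr2 ler_wpM2r //; lra.
(* The term 9/4 x matches the cubic coefficient 9/2; 3 is the largest integer keeping the x ^+ 2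
   coefficient of the difference, 1/16, nonnegative. *)
have hb2 : b <= x ^+ 2 - 9 / 4 * x - 3.
  rewrite leNgt; apply/negP => /sqr_lt; move/(_ ltac:(lra)).
  apply/negP; rewrite -leNgt; apply: le_trans hb _.
  by rewrite -subr_ge0 (_ : _ - _ = x ^+ 2 / 16 + 45 / 4 * x + 6); [lra | field].
rewrite leNgt; apply/negP => h.
(* This solves [h] for c using [hb2]. As (27/16)^2 > 2, c (c + 1) then exceeds 2 b. *)
have /sqr_lt : 27 / 16 * x - 13 / 4 < c by lra.
move/(_ ltac:(lra)); lra.
Qed.

Section BlockDiagonal.

Variables (k : fieldType) (t : nat) (d : 'I_t -> nat).
Local Notation n := (\sum_(i < t) d i)%N.

(** Inclusion and projection of the i-th coordinate block. The orthogonality relations and the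
    resolution of the identity below yield the algebra structure without entrywise computation. *)
Definition block_out (i : 'I_t) : 'M[k]_(n, d i) := submxrow 1%:M i.
Definition block_in (i : 'I_t) : 'M[k]_(d i, n) := submxcol 1%:M i.

Lemma block_in_outE i j :
  block_in i *m block_out j = submxblock (\mxdiag_i (1%:M : 'M[k]_(d i))) i j.
Proof.
by rewrite mul_submxrow submxcol_mul mulmx1 -submxblockEv mxdiagZ.
Qed.

Lemma block_in_outK i : block_in i *m block_out i = 1%:M.
Proof. by rewrite block_in_outE submxblock_diag. Qed.

Lemma block_in_out0 i j : i != j -> block_in i *m block_out j = 0.
Proof. by move=> /negPf ij; rewrite block_in_outE mxblockK ij. Qed.

Lemma sum_block_out_in : \sum_i block_out i *m block_in i = 1%:M.
Proof. by rewrite -mul_mxrow_mxcol submxrowK submxcolK mulmx1. Qed.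

Definition block_embed (i : 'I_t) (B : 'M[k]_(d i)) : 'M[k]_n :=
  block_out i *m B *m block_in i.

Lemma block_embed_is_linear i : linear (@block_embed i).
Proof.
by move=> a B C; rewrite /block_embed mulmxDr mulmxDl -scalemxAr -scalemxAl.
Qed.

HB.instance Definition _ i := GRing.isLinear.Build k 'M[k]_(d i) 'M[k]_n _
  (@block_embed i) (@block_embed_is_linear i).

Lemma block_embedK i :
  cancel (@block_embed i) (fun A => block_in i *m A *m block_out i).
Proof.
move=> B; rewrite /block_embed !mulmxA block_in_outK mul1mx -mulmxA.
by rewrite block_in_outK mulmx1.
Qed.

Lemma block_embedM i B C :
  @block_embed i B *m @block_embed i C = block_embed (B *m C).
Proof.
rewrite /block_embed !mulmxA -(mulmxA _ (block_in i)) block_in_outK mulmx1.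
by rewrite -(mulmxA _ B C).
Qed.

Lemma block_embedM0 i j B C :
  i != j -> @block_embed i B *m @block_embed j C = 0.
Proof.
move=> ij; rewrite /block_embed !mulmxA -(mulmxA _ (block_in i)).
by rewrite block_in_out0 // mulmx0 !mul0mx.
Qed.

Definition mxsum_diag (u : mxsum k d) : 'M[k]_n := \sum_i block_embed (u i).

Lemma mxsum_diag_is_linear : linear mxsum_diag.
Proof.
move=> a u v; rewrite scaler_sumr -big_split; apply: eq_bigr => i _ /=.
by rewrite !ffunE linearP.
Qed.

HB.instance Definition _ := GRing.isLinear.Build k (mxsum k d) 'M[k]_n _
  mxsum_diag mxsum_diag_is_linear.

Lemma mxsum_diag_monoid_morphism : monoid_morphism mxsum_diag.
Proof.
split=> [|u v].
  rewrite /mxsum_diag -[RHS]sum_block_out_in; apply: eq_bigr => i _.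
  by rewrite ffunE /block_embed mulmx1.
rewrite /mxsum_diag mulr_suml; apply: eq_bigr => i _.
rewrite mulr_sumr [RHS](bigD1 i) //= [X in _ + X]big1 ?addr0 => [|j ij].
  by rewrite ffunE -block_embedM.
by rewrite -[LHS]/(_ *m _) block_embedM0 // eq_sym.
Qed.

Lemma mxsum_diagK (u : mxsum k d) i :
  block_in i *m mxsum_diag u *m block_out i = u i.
Proof.
rewrite /mxsum_diag mulmx_sumr mulmx_suml (bigD1 i) //= block_embedK.
rewrite big1 ?addr0 // => j ij.
by rewrite /block_embed !mulmxA block_in_out0 1?eq_sym // !mul0mx.
Qed.

Lemma mxsum_diag_inj : injective mxsum_diag.
Proof.
by move=> u v uv; apply/ffunP => i; rewrite -!mxsum_diagK uv.
Qed.

(** Written as a sum of images, so that its dimension is read off once the sum is known to be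
    direct. *)
Definition block_diagonal : {vspace 'M[k]_n} :=
  (\sum_i limg (linfun (@block_embed i)))%VS.

Lemma block_diagonalP A :
  reflect (exists u, mxsum_diag u = A) (A \in block_diagonal).
Proof.
apply: (iffP memv_sumP) => [[B memB ->]|[u <-]]; last first.
  exists (fun i => block_embed (u i)) => // i _.
  by rewrite -[block_embed _]lfunE memv_img ?memvf.
exists (finfun (fun i => block_in i *m B i *m block_out i) : mxsum k d).
apply: eq_bigr => i _; rewrite ffunE; have /memv_imgP[C _ ->] := memB i isT.
by rewrite lfunE /= block_embedK.
Qed.

Lemma dim_block_diagonal : \dim block_diagonal = (\sum_i d i ^ 2)%N.
Proof.
have /directvP/= -> : directv block_diagonal.
  apply/directv_sum_independent => B memB sumB0 i _.
  pose C : mxsum k d := finfun (fun j => block_in j *m B j *m block_out j).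
  have defB j : B j = block_embed (C j).
    rewrite ffunE; have /memv_imgP[D _ ->] := memB j isT.
    by rewrite lfunE /= block_embedK.
  (* Directness reduces to injectivity of [mxsum_diag]. *)
  suff C0 : C = 0 by rewrite defB C0 ffunE linear0.
  apply: mxsum_diag_inj; rewrite linear0 -sumB0.
  by apply: eq_bigr => j _; rewrite -defB.
apply: eq_bigr => i _; rewrite limg_dim_eq ?dimvf ?/dim /=.
  by rewrite -mulnn.
apply/eqP; rewrite capfv; apply/lker0P => B C; rewrite !lfunE /=.
exact: (can_inj (@block_embedK i)).
Qed.

Lemma block_diagonal_is_CSA : (forall i, 0 < d i)%N -> is_CSA block_diagonal.
Proof.
move=> d_gt0; have [f1 fM] := mxsum_diag_monoid_morphism; split.
  split; first by apply/block_diagonalP; exists 1.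
  move=> _ _ /block_diagonalP[u <-] /block_diagonalP[v <-].
  by apply/block_diagonalP; exists (u * v).
exists t, d, mxsum_diag; split=> //; first exact: mxsum_diag_inj.
by move=> A; split=> [/block_diagonalP|?] //; apply/block_diagonalP.
Qed.

End BlockDiagonal.

Lemma decomposable_CSA (k : fieldType) (n m : nat) : decomposable n m ->
  exists A : {vspace 'M[k]_n}, is_CSA A /\ \dim A = (n + 2 * m)%N.
Proof.
case=> l [/all_nthP l_gt0 sum_l sum_bin].
pose d (i : 'I_(size l)) := nth 0%N l i.
have sum_d : (\sum_(i < size l) d i)%N = n.
  by rewrite -sum_l sumnE (big_nth 0%N) big_mkord.
(* The matrix size must be the very sum that types [block_diagonal]. *)
rewrite -sum_d; exists (block_diagonal k d); split.
  by apply: block_diagonal_is_CSA => i; apply: l_gt0.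
rewrite dim_block_diagonal (eq_bigr _ (fun i _ => sqrn_bin2 (d i))).
rewrite big_split sum_d -big_distrr /= -sum_bin sumnE big_map.
by rewrite (big_nth 0%N) big_mkord.
Qed.

Theorem theorem5 (k : fieldType) (R : rcfType) (n m : nat)
    (hn : (225 <= n)%N)
    (hm : (2 * m)%:R <= n%:R ^+ 2 - 9%:R / 2%:R * n%:R * Num.sqrt n%:R :> R) :
  exists A : {vspace 'M[k]_n}, is_CSA A /\ \dim A = (n + 2 * m)%N.
Proof.
apply: decomposable_CSA.
have [b [r [def_m r_le]]] := triangular_root m.
have [c [q [def_r q_le]]] := triangular_root r.
have [s le_s] := decomposable_greedy b _ _ q_le; rewrite -def_r -def_m.
apply: decomposable_leq.
suff: (3 * b + 4 * c + 22 <= 3 * n)%N by lia.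
set x : R := Num.sqrt n%:R in hm.
have x2 : x ^+ 2 = n%:R by rewrite sqr_sqrtr.
have x_ge : 15%:R <= x.
  by rewrite -(@ler_pXn2r _ 2) ?nnegrE ?sqrtr_ge0 // x2 -natrX ler_nat.
have hb : b%:R * (b%:R + 1) <= (2 * m)%:R :> R.
  by rewrite natr1 -natrM ler_nat -bin2M2; lia.
(* The first remainder satisfies r <= b, hence 'C(c.+1, 2) <= b. *)
have hc : c%:R * (c%:R + 1) <= 2 * b%:R :> R.
  by rewrite natr1 -!natrM ler_nat -bin2M2; lia.
rewrite -(ler_nat R) 2!natrD !natrM -x2; apply: greedy_cost_bound => //.
by apply: le_trans hb (le_trans hm _); rewrite -x2 -exprM.
Qed.
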